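(* As formal power series in $q$, we have \[\frac{q\frac{d}{dq}\Psi(Q;q)}{\Psi(Q;q)} = -F_{\widehat{Q}}(q).\] Moreover, for all integers $n\geq 1$ we have \[Q(n) = \sum_{d\mid n}\mu(d)\,\widehat{Q}(n/d),\] where $\mu$ denotes the Möbius function and the sum runs over the positive divisors $d$ of $n$.
   Context: For a nonnegative integer $n$, $Q(n)$ denotes the number of partitions of $n$ into distinct parts, and $\widehat{Q}(n)$ denotes the number of partitions of $n$ whose parts all occur with the same multiplicity (i.e. there is a positive integer $m$ such that every part that occurs in the partition occurs exactly $m$ times). Define the formal power series \[F_{\widehat{Q}}(q) := \sum_{n=1}^\infty \widehat{Q}(n)q^n, \qquad \Psi(Q;q) := \prod_{n=1}^\infty (1-q^n)^{Q(n)/n},\] where for a rational exponent $r$ the power $(1-q^n)^r$ is the binomial series $\sum_{k\ge 0}\binom{r}{k}(-1)^k q^{nk}$. *)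

(* Defs.v *)
From HB Require Import structures.
From mathcomp Require Import all_boot all_order all_algebra.
From mathcomp Require Import boolp.

Set Implicit Arguments.
Unset Strict Implicit.
Unset Printing Implicit Defensive.

Import GRing.Theory.
Local Open Scope nat_scope.

Definition is_partition (n : nat) (s : seq nat) : bool :=
  [&& sorted geq s, all (ltn 0) s & sumn s == n].

(* A partition of [n] has at most [n] parts, each at most [n]; hence the finite
   type [n.-bseq 'I_n.+1] contains every partition of [n], exactly once (see
   [is_partition_bseq] below). *)
Definition count_partitions (P : pred (seq nat)) (n : nat) : nat :=
  #|[set t : n.-bseq 'I_n.+1 |
       is_partition n (map val t) && P (map val t)]|.

Definition Q (n : nat) : nat := count_partitions uniq n.

Definition equal_mult (s : seq nat) : bool :=
  constant [seq count_mem p s | p <- s].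

Definition Qhat (n : nat) : nat := count_partitions equal_mult n.

Lemma equal_multP (s : seq nat) :
  reflect (exists2 m, 0 < m & {in s, forall p, count_mem p s = m})
          (equal_mult s).
Proof.
rewrite /equal_mult; apply: (iffP idP) => [|[m _ sm]].
- case: s => [|p s]; first by exists 1.
  set t := p :: s; have tp : p \in t by rewrite mem_head.
  rewrite /constant map_cons -/t => /allP H.
  exists (count_mem p t) => [|r]; first by rewrite -has_count has_pred1.
  rewrite inE => /predU1P[-> //|rs]; apply/eqP/H.
  exact: (map_f (fun p => count_mem p t)).
- case: s sm => [//|p s] sm; rewrite /constant map_cons.
  apply/allP => _ /mapP[r rs ->] /=.
  by apply/eqP; rewrite [LHS]sm ?[RHS]sm ?mem_head // inE rs orbT.
Qed.

Lemma is_partition_bseq (n : nat) (s : seq nat) : is_partition n s ->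
  exists! t : n.-bseq 'I_n.+1, map val t = s.
Proof.
case/and3P=> _ s_gt0 /eqP s_n.
have sz : size s <= n.
  rewrite -s_n; elim: s s_gt0 {s_n} => //= x s IHs /andP[x0 s0].
  by rewrite -add1n leq_add ?IHs.
have mx x : x \in s -> x < n.+1.
  rewrite ltnS -s_n; elim: s {s_gt0 s_n sz} => //= y s IHs.
  rewrite inE => /predU1P[->|/IHs]; first exact: leq_addr.
  by move/leq_trans; apply; apply: leq_addl.
have sz' : size [seq inord x : 'I_n.+1 | x <- s] <= n by rewrite size_map.
have tE : map val [seq inord x : 'I_n.+1 | x <- s] = s.
  rewrite -map_comp -[RHS]map_id; apply/eq_in_map => x xs /=.
  by rewrite inordK // mx.
exists (Bseq sz'); split=> // t tE'.
by apply/val_inj/(inj_map val_inj); rewrite /= tE tE'.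
Qed.

Definition moebius (d : nat) : int :=
  if all (fun p => logn p d == 1) (primes d)
  then ((-1) ^+ size (primes d))%R else 0%R.

Local Open Scope ring_scope.

Record fps (K : Type) := Fps { fps_coef :> nat -> K }.

Lemma fpsP (K : Type) (f g : fps K) : (forall n, f n = g n) -> f = g.
Proof. by case: f g => [f] [g] /= fg; congr Fps; apply: funext. Qed.

HB.instance Definition _ (K : Type) := gen_eqMixin (fps K).
HB.instance Definition _ (K : Type) := gen_choiceMixin (fps K).

Section FpsRing.
Variable K : fieldType.
Implicit Types f g h : fps K.

Definition fps_zero : fps K := Fps (fun=> 0).
Definition fps_opp f : fps K := Fps (fun n => - f n).
Definition fps_add f g : fps K := Fps (fun n => f n + g n).
Definition fps_one : fps K := Fps (fun n => (n == 0%N)%:R).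
Definition fps_mul f g : fps K :=
  Fps (fun n => \sum_(i < n.+1) f i * g (n - i)%N).

Lemma fps_addA : associative fps_add.
Proof. by move=> f g h; apply: fpsP => n /=; rewrite addrA. Qed.
Lemma fps_addC : commutative fps_add.
Proof. by move=> f g; apply: fpsP => n /=; rewrite addrC. Qed.
Lemma fps_add0 : left_id fps_zero fps_add.
Proof. by move=> f; apply: fpsP => n /=; rewrite add0r. Qed.
Lemma fps_addN : left_inverse fps_zero fps_opp fps_add.
Proof. by move=> f; apply: fpsP => n /=; rewrite addNr. Qed.

HB.instance Definition _ :=
  GRing.isZmodule.Build (fps K) fps_addA fps_addC fps_add0 fps_addN.

Definition fps_trunc N f : {poly K} := \poly_(i < N.+1) f i.

Lemma coef_fps_trunc N f i : (i <= N)%N -> (fps_trunc N f)`_i = f i.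
Proof. by move=> iN; rewrite coef_poly ltnS iN. Qed.

Lemma fps_mulE N f g n : (n <= N)%N ->
  fps_mul f g n = (fps_trunc N f * fps_trunc N g)`_n.
Proof.
move=> nN; rewrite coefM; apply: eq_bigr => i _.
rewrite !coef_fps_trunc //; first exact: leq_trans (leq_subr _ _) nN.
by apply: leq_trans nN; rewrite -ltnS.
Qed.

Lemma coefM_eq (p p' q q' : {poly K}) n :
    (forall i, (i <= n)%N -> p`_i = p'`_i) ->
    (forall i, (i <= n)%N -> q`_i = q'`_i) ->
  (p * q)`_n = (p' * q')`_n.
Proof.
move=> pp' qq'; rewrite !coefM; apply: eq_bigr => i _.
by rewrite pp' ?qq' ?leq_subr // -ltnS.
Qed.

Lemma fps_mulA : associative fps_mul.
Proof.
move=> f g h; apply: fpsP => n; rewrite !(@fps_mulE n) //.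
transitivity ((fps_trunc n f * (fps_trunc n g * fps_trunc n h))`_n).
  by apply: coefM_eq => // i i_n; rewrite coef_fps_trunc // (@fps_mulE n).
rewrite mulrA; apply: coefM_eq => // i i_n.
by rewrite coef_fps_trunc // (@fps_mulE n).
Qed.

Lemma fps_mulC : commutative fps_mul.
Proof. by move=> f g; apply: fpsP => n; rewrite !(@fps_mulE n) // mulrC. Qed.

Lemma fps_mul1 : left_id fps_one fps_mul.
Proof.
move=> f; apply: fpsP => n /=.
rewrite big_ord_recl /= mul1r subn0 big1 ?addr0 // => i _.
by rewrite mul0r.
Qed.

Lemma fps_mulDl : left_distributive fps_mul fps_add.
Proof.
move=> f g h; apply: fpsP => n /=; rewrite -big_split /=.
by apply: eq_bigr => i _; rewrite mulrDl.
Qed.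

Lemma fps_one_neq0 : fps_one != 0 :> fps K.
Proof.
apply/eqP => /(congr1 (fun f : fps K => f 0%N)) /= /eqP.
by rewrite oner_eq0.
Qed.

HB.instance Definition _ := GRing.Zmodule_isComNzRing.Build (fps K)
  fps_mulA fps_mulC fps_mul1 fps_mulDl fps_one_neq0.

Lemma fps_coef0 n : (0 : fps K) n = 0. Proof. by []. Qed.
Lemma fps_coef1 n : (1 : fps K) n = (n == 0%N)%:R. Proof. by []. Qed.
Lemma fps_coefN f n : (- f) n = - f n. Proof. by []. Qed.
Lemma fps_coefD f g n : (f + g) n = f n + g n. Proof. by []. Qed.
Lemma fps_coefB f g n : (f - g) n = f n - g n. Proof. by []. Qed.
Lemma fps_coefM f g n : (f * g) n = \sum_(i < n.+1) f i * g (n - i)%N.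
Proof. by []. Qed.
Lemma fps_coef_sum (I : Type) (r : seq I) (P : pred I) (F : I -> fps K) n :
  (\sum_(i <- r | P i) F i) n = \sum_(i <- r | P i) F i n.
Proof. by elim/big_rec2: _ => // i x y _ <-. Qed.

Lemma fps_coefM_low f g k m n :
    (forall i, (i < k)%N -> f i = 0) -> (forall i, (i < m)%N -> g i = 0) ->
  (n < k + m)%N -> (f * g) n = 0.
Proof.
move=> f0 g0 n_km; rewrite fps_coefM big1 // => i _.
case: (ltnP i k) => [/f0 -> | ki]; first by rewrite mul0r.
rewrite g0 ?mulr0 // ltn_subLR; last by rewrite -ltnS.
by apply: leq_trans n_km _; rewrite leq_add2r.
Qed.

(* 1 / f = (1 / f_0) * sum_k (1 - f / f_0)^k; only the terms with k <= n
   contribute to the coefficient of q^n. *)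
Definition fps_unit : {pred fps K} := fun f => f 0%N != 0.
Definition fps_scale (c : K) f : fps K := Fps (fun n => c * f n).
Definition fps_inv f : fps K :=
  if f \in fps_unit then
    Fps (fun n => (f 0%N)^-1 *
      (\sum_(k < n.+1) (1 - fps_scale (f 0%N)^-1 f) ^+ k) n)
  else f.

Lemma fps_coefX_low h k n : h 0%N = 0 -> (n < k)%N -> (h ^+ k) n = 0.
Proof.
move=> h0; elim: k n => // k IHk n nk; rewrite exprS.
by apply: (@fps_coefM_low _ _ 1 k) => //; case.
Qed.

Lemma fps_mulVf : {in fps_unit, left_inverse 1 fps_inv *%R}.
Proof.
move=> f fU; have f0 : f 0%N != 0 by [].
rewrite /fps_inv fU; set c := (f 0%N)^-1; set h := 1 - _.
have h0 : h 0%N = 0 by rewrite fps_coefB /= mulVf // subrr.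
have hE : 1 - h = fps_scale c f by rewrite /h opprB addrC subrK.
apply: fpsP => n; rewrite fps_coefM.
transitivity (((\sum_(k < n.+1) h ^+ k) * (1 - h)) n).
  rewrite fps_coefM; apply: eq_bigr => i _.
  rewrite hE /= -/c [c * _]mulrC -mulrA; congr (_ * _).
  rewrite !fps_coef_sum.
  rewrite -[RHS](big_mkord xpredT (fun k => (h ^+ k) i)).
  rewrite (big_cat_nat (n := i.+1)) //= [X in _ + X]big1_seq ?addr0 ?big_mkord //.
  by move=> k /andP[_]; rewrite mem_index_iota => /andP[ik _]; apply: fps_coefX_low.
rewrite mulrC -[1 - h]opprB mulNr -subrX1 opprB fps_coefB.
by rewrite fps_coefX_low // subr0.
Qed.

Lemma fps_unitPl f g : g * f = 1 -> fps_unit f.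
Proof.
move/(congr1 (fun h : fps K => h 0%N)); rewrite fps_coefM big_ord1 /= => gf1.
by apply/eqP => f0; move/eqP: gf1; rewrite f0 mulr0 eq_sym oner_eq0.
Qed.

Lemma fps_inv_out : {in [predC fps_unit], fps_inv =1 id}.
Proof. by move=> f; rewrite inE /= /fps_inv => /negPf ->. Qed.

HB.instance Definition _ := GRing.ComNzRing_hasMulInverse.Build (fps K)
  fps_mulVf fps_unitPl fps_inv_out.

Definition fps_X : fps K := Fps (fun n => (n == 1%N)%:R).

Definition fps_deriv f : fps K := Fps (fun n => f n.+1 *+ n.+1).

(* [u] converges to [l] in the q-adic topology. *)
Definition fps_cvg (u : nat -> fps K) (l : fps K) : Prop :=
  forall k, exists N, forall n, (N <= n)%N -> u n k = l k.

(* The infinite product of [F n] over n >= 1, for families such that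
   F n = 1 mod q^n: the factors with n > k do not affect the coefficient of
   q^k (see [fps_infprod_cvg]). *)
Definition fps_infprod (F : nat -> fps K) : fps K :=
  Fps (fun k => (\prod_(1 <= n < k.+1) F n) k).

Lemma fps_infprod_cvg (F : nat -> fps K) :
    (forall n i, (i < n)%N -> F n i = (1 : fps K) i) ->
  fps_cvg (fun N => \prod_(1 <= n < N.+1) F n) (fps_infprod F).
Proof.
move=> F1 k; exists k => n /subnK <-; rewrite addnC.
elim: (n - k)%N => [|j IHj]; first by rewrite addn0.
rewrite addnS; set P := \prod_(1 <= i < (k + j).+1) F i in IHj.
have -> : \prod_(1 <= i < (k + j).+2) F i = P + P * (F (k + j).+1 - 1).
  by rewrite big_nat_recr // mulrBr mulr1 addrC subrK.
rewrite fps_coefD IHj.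
rewrite (@fps_coefM_low _ _ 0 (k + j).+1) ?addr0 ?ltnS ?leq_addr // => i ik.
by rewrite fps_coefB F1 // subrr.
Qed.

End FpsRing.

Definition gbinom (r : rat) (k : nat) : rat :=
  (\prod_(i < k) (r - i%:R)) / k`!%:R.

(* (1 - q^n)^r = sum_k gbinom r k * (-1)^k * q^(n k), for n >= 1. *)
Definition one_sub_Xn_pow (n : nat) (r : rat) : fps rat :=
  Fps (fun i => if (n %| i)%N
                then gbinom r (i %/ n) * (-1) ^+ (i %/ n) else 0).

Definition Psi_factor (a : nat -> nat) (n : nat) : fps rat :=
  one_sub_Xn_pow n ((a n)%:R / n%:R).

Definition Psi (a : nat -> nat) : fps rat := fps_infprod (Psi_factor a).

Lemma Psi_cvg (a : nat -> nat) :
  fps_cvg (fun N => \prod_(1 <= n < N.+1) Psi_factor a n) (Psi a).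
Proof.
apply: fps_infprod_cvg => n [|i] i_n; rewrite fps_coef1 /=.
  by rewrite dvdn0 div0n /gbinom big_ord0 fact0 mulr1 divr1.
by case: ifP => // /(dvdn_leq (ltn0Sn i)); rewrite leqNgt i_n.
Qed.

Lemma Psi_unit (a : nat -> nat) : Psi a \is a GRing.unit.
Proof.
suff -> : (Psi a \is a GRing.unit) = (Psi a 0%N != 0) by rewrite /= big_geq.
by [].
Qed.

Definition F_Qhat : fps rat :=
  Fps (fun n => if n == 0%N then 0 else (Qhat n)%:R).

(* Main.v *)
(* A partition of n >= 1 whose parts all have multiplicity m is m copies of a
   partition of n / m into distinct parts, so Qhat(n) = sum_{d | n} Q(d), and
   Moebius inversion gives the formula for Q. On the other side, the logarithmic
   derivative q d/dq log (1 - q^n)^(Q(n)/n) is -Q(n) q^n / (1 - q^n); summing over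
   n, the coefficient of q^k is -sum_{n | k} Q(n) = -Qhat(k). *)
Require Import Defs.
From mathcomp Require Import all_boot all_order all_algebra.
From mathcomp Require Import ring.

Set Implicit Arguments.
Unset Strict Implicit.
Unset Printing Implicit Defensive.

Import GRing.Theory Num.Theory.

Lemma divn_dvd_gt0 n d : 0 < n -> d %| n -> 0 < n %/ d.
Proof. by move=> n0 dn; rewrite divn_gt0 ?(dvdn_gt0 n0 dn) // dvdn_leq. Qed.

(** * Equal-multiplicity partitions as repeated partitions into distinct parts *)

Section Partitions.
Implicit Types (s t : seq nat) (P : pred (seq nat)).

(** The set behind [count_partitions], as a list of plain sequences: a count can then be computed by
    exhibiting any duplicate-free list with the same members. *)
Definition partitions P n : seq (seq nat) :=
  [seq map val t | t : n.-bseq 'I_n.+1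
     in [set t : n.-bseq 'I_n.+1 | is_partition n (map val t) && P (map val t)]].

Lemma size_partitions P n : size (partitions P n) = count_partitions P n.
Proof. by rewrite size_map -cardE. Qed.

Lemma partitions_uniq P n : uniq (partitions P n).
Proof.
rewrite map_inj_uniq ?enum_uniq // => t u /(inj_map val_inj).
exact: val_inj.
Qed.

Lemma mem_partitions P n s : (s \in partitions P n) = is_partition n s && P s.
Proof.
apply/mapP/andP => [[t]|[sn Ps]].
  by rewrite mem_enum inE => /andP[tn Pt] ->.
have [t [ts _]] := is_partition_bseq sn.
by exists t; rewrite // mem_enum inE ts sn.
Qed.

Lemma count_partitions_size P n (L : seq (seq nat)) : uniq L ->
  (forall s, (s \in L) = is_partition n s && P s) ->
  count_partitions P n = size L.
Proof.
move=> uL LE; rewrite -size_partitions; apply/perm_size/uniq_perm => //.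
  exact: partitions_uniq.
by move=> s; rewrite mem_partitions LE.
Qed.

Lemma sorted_geq_eq s t : sorted geq s -> sorted geq t -> perm_eq s t -> s = t.
Proof.
apply: sorted_eq; first by move=> x y z; rewrite /geq /= => yx zx; apply: leq_trans zx yx.
by move=> x y; rewrite /geq /= andbC -eqn_leq => /eqP.
Qed.

(** Multiplies every multiplicity by [m]; sorting restores the canonical non-increasing order. *)
Definition repeat_parts m s := sort geq (flatten (nseq m s)).

Lemma count_repeat_parts a m s : count a (repeat_parts m s) = m * count a s.
Proof.
rewrite /repeat_parts (permP (permEl (perm_sort _ _))) count_flatten map_nseq.
by rewrite sumn_nseq mulnC.
Qed.

Lemma repeat_parts_sorted m s : sorted geq (repeat_parts m s).
Proof. by apply: sort_sorted => x y; apply: leq_total. Qed.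

Lemma sumn_repeat_parts m s : sumn (repeat_parts m s) = m * sumn s.
Proof.
rewrite (perm_sumn (permEl (perm_sort _ _))) sumn_flatten map_nseq.
by rewrite sumn_nseq mulnC.
Qed.

Lemma mem_repeat_parts m s : 0 < m -> repeat_parts m s =i s.
Proof.
by move=> m0 x; rewrite -!has_pred1 !has_count count_repeat_parts muln_gt0 m0.
Qed.

(** Repetition keeps the set of parts, and a sorted duplicate-free sequence is determined by that
    set, even when [m1] and [m2] are not known to agree. *)
Lemma repeat_parts_inj m1 m2 s1 s2 : 0 < m1 -> 0 < m2 ->
    uniq s1 -> uniq s2 -> sorted geq s1 -> sorted geq s2 ->
  repeat_parts m1 s1 = repeat_parts m2 s2 -> s1 = s2.
Proof.
move=> m1_gt0 m2_gt0 u1 u2 o1 o2 E; apply/sorted_geq_eq/uniq_perm => // x.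
by rewrite -(mem_repeat_parts _ m1_gt0) E mem_repeat_parts.
Qed.

Lemma repeat_parts_is_partition m n s : 0 < m -> is_partition n s ->
  is_partition (m * n) (repeat_parts m s).
Proof.
move=> m0 /and3P[_ s0 /eqP sn].
rewrite /is_partition repeat_parts_sorted sumn_repeat_parts sn eqxx andbT.
by apply/allP => x; rewrite mem_repeat_parts //; apply: (allP s0).
Qed.

Lemma repeat_parts_equal_mult m s : 0 < m -> uniq s ->
  equal_mult (repeat_parts m s).
Proof.
move=> m0 us; apply/equal_multP; exists m => // x.
by rewrite mem_repeat_parts // count_repeat_parts count_uniq_mem // => ->; rewrite muln1.
Qed.

Lemma equal_mult_repeat_parts n t : is_partition n t -> equal_mult t ->
  exists m s, [/\ 0 < m, m * sumn s = n, is_partition (sumn s) s, uniq s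
                & t = repeat_parts m s].
Proof.
case/and3P=> ot t0 /eqP tn /equal_multP[m m0 tm].
(* With [m] the common multiplicity, the underlying distinct parts are [undup t]; both sides are
   sorted, so comparing multiplicities suffices. *)
have tE : t = repeat_parts m (undup t).
  apply: sorted_geq_eq => //; first exact: repeat_parts_sorted.
  rewrite /perm_eq; apply/allP => x _; apply/eqP; rewrite count_repeat_parts.
  rewrite [in RHS]count_uniq_mem ?undup_uniq // mem_undup.
  case: (boolP (x \in t)) => [/tm ->|]; first by rewrite muln1.
  by rewrite muln0; move/count_memPn.
exists m, (undup t); split=> //; last exact: undup_uniq.
- by rewrite -sumn_repeat_parts -tE.
rewrite /is_partition eqxx andbT; apply/andP; split.
  apply: subseq_sorted ot; last exact: undup_subseq.
  by move=> x y z; rewrite /geq /= => yx zx; apply: leq_trans zx yx.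
by apply/allP => x; rewrite mem_undup; apply: (allP t0).
Qed.

Lemma Qhat_sum_Q n : 0 < n -> Qhat n = \sum_(d <- divisors n) Q d.
Proof.
move=> n0.
have quo_gt0 d : d \in divisors n -> 0 < n %/ d.
  by rewrite -dvdn_divisors //; apply: divn_dvd_gt0.
(* Here [d] is the sum of the distinct parts, so the multiplicity has to be [n %/ d]. *)
pose L := [seq repeat_parts (n %/ d) s | d <- divisors n, s <- partitions uniq d].
rewrite /Qhat (@count_partitions_size _ _ L).
- rewrite size_allpairs_dep sumnE big_map.
  by apply: eq_bigr => d _; rewrite size_partitions.
- apply: allpairs_uniq_dep => [|d _|]; rewrite ?divisors_uniq ?partitions_uniq //.
  move=> u v /allpairsPdep[d1 [s1 [d1n s1P ->]]].
  move=> /allpairsPdep[d2 [s2 [d2n s2P ->]]] /= E.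
  move: s1P s2P; rewrite !mem_partitions.
  case/andP=> /and3P[o1 _ /eqP s1d] u1 /andP[/and3P[o2 _ /eqP s2d] u2].
  (* Equal underlying partitions have equal sums, which recovers the index [d]. *)
  have s12 : s1 = s2 by apply: repeat_parts_inj E => //; apply: quo_gt0.
  by rewrite -s1d -s2d s12.
move=> t; apply/allpairsPdep/andP => [[d [s [dn]]]|[tn et]].
  rewrite mem_partitions => /andP[sd us] ->; split.
    have {1}-> : n = n %/ d * d by rewrite divnK // dvdn_divisors.
    by apply: repeat_parts_is_partition => //; apply: quo_gt0.
  by apply: repeat_parts_equal_mult => //; apply: quo_gt0.
have [m [s [m0 msn sp us tE]]] := equal_mult_repeat_parts tn et.
have s0 : 0 < sumn s by move: n0; rewrite -msn muln_gt0 => /andP[].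
exists (sumn s), s; split.
- by rewrite -dvdn_divisors // -msn dvdn_mull.
- by rewrite mem_partitions sp.
- by rewrite -msn mulnK.
Qed.

End Partitions.

(** * Möbius inversion over divisors *)

Section Moebius.
Local Open Scope ring_scope.

(** If [p] divides [d], the square of [p] divides [p * d]; otherwise [p * d] has exactly one more
    prime factor, and the other exponents are unchanged. *)
Lemma moebius_primeM p d : prime p -> (0 < d)%N ->
  moebius (p * d) = if (p %| d)%N then 0 else - moebius d.
Proof.
move=> pp d0; have p0 := prime_gt0 pp.
have logpd r : prime r -> logn r (p * d) = ((r == p) + logn r d)%N.
  by move=> rp; rewrite lognM // (logn_prime _ pp).
case: ifP => pd.
  rewrite /moebius ifF //; apply/negP => /allP /(_ p).
  rewrite mem_primes pp muln_gt0 p0 d0 dvdn_mulr // => /(_ isT).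
  by rewrite logpd // eqxx add1n eqSS -leqn0 leqNgt logn_gt0 mem_primes pp d0 pd.
have pP : perm_eq (primes (p * d)) (p :: primes d).
  apply: uniq_perm; rewrite /= ?primes_uniq ?andbT //.
    by rewrite mem_primes pd !andbF.
  by move=> r; rewrite primesM // primes_prime // !inE.
rewrite /moebius (perm_all _ pP) (perm_size pP) /= logpd // eqxx.
rewrite (_ : logn p d = 0%N) /=; last first.
  by apply/eqP; rewrite -leqn0 leqNgt logn_gt0 mem_primes pd !andbF.
rewrite (@eq_in_all _ _ (fun r => logn r d == 1%N)) => [|r]; last first.
  rewrite mem_primes => /and3P[rp _ rd]; rewrite logpd //.
  by case: (eqVneq r p) rd => // ->; rewrite pd.
by case: ifP => _; rewrite ?oppr0 // exprS mulN1r.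
Qed.

(** For a prime [p] dividing [n], the divisors that are multiples of [p] are the [p * e] with [e]
    dividing [n %/ p]. Those with [p] dividing [e] contribute 0; the others cancel against the
    divisors of [n] prime to [p], which are the divisors of [n %/ p] prime to [p]. *)
Lemma sum_moebius n : (0 < n)%N ->
  \sum_(d <- divisors n) moebius d = (n == 1%N)%:R :> int.
Proof.
move=> n0; have [->|n1] := eqVneq n 1%N; first by rewrite /= big_seq1.
set p := pdiv n.
have pp : prime p by rewrite pdiv_prime // ltn_neqAle eq_sym n1.
have p0 := prime_gt0 pp.
have nE : n = (p * (n %/ p))%N by rewrite mulnC divnK // pdiv_dvd.
have np0 : (0 < n %/ p)%N by move: n0; rewrite {1}nE muln_gt0 => /andP[].
rewrite (bigID (fun d => p %| d)%N) /=.
rewrite -big_filter (perm_big [seq (p * d)%N | d <- divisors (n %/ p)]); last first.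
  apply: uniq_perm; rewrite ?filter_uniq ?divisors_uniq //.
    rewrite map_inj_uniq ?divisors_uniq // => x y /eqP.
    by rewrite eqn_pmul2l // => /eqP.
  move=> d; rewrite mem_filter -dvdn_divisors //; apply/andP/mapP => [[]|[e]].
    case/dvdnP => e ->; rewrite {1}nE mulnC dvdn_pmul2l // => en.
    by exists e; rewrite // -dvdn_divisors.
  by rewrite -dvdn_divisors // => en ->; rewrite {1}nE dvdn_pmul2l ?dvdn_mulr.
rewrite big_map (eq_big_seq (fun d => if (p %| d)%N then 0 else - moebius d)); last first.
  move=> d; rewrite -dvdn_divisors // => dn.
  by rewrite moebius_primeM // (dvdn_gt0 np0 dn).
rewrite addrC -big_filter (perm_big [seq d <- divisors (n %/ p) | ~~ (p %| d)%N]).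
  rewrite big_filter addrC [X in X + _](bigID (fun d => p %| d)%N) /=.
  rewrite big1 => [|d ->//]; rewrite add0r -big_split big1 //= => d /negPf ->.
  by rewrite addNr.
apply: uniq_perm; rewrite ?filter_uniq ?divisors_uniq // => d.
rewrite !mem_filter -!dvdn_divisors //; have [//|pd /=] := boolP (p %| d)%N.
by rewrite {1}nE Gauss_dvdr // coprime_sym prime_coprime.
Qed.

(** Expand [g] and exchange the sums over pairs with [d * e] dividing [n]: the inner sum of
    [moebius] over the divisors of [n %/ e] vanishes unless [e = n]. *)
Lemma moebius_inversion (f g : nat -> int) :
    (forall n, (0 < n)%N -> g n = \sum_(d <- divisors n) f d) ->
  forall n, (0 < n)%N -> f n = \sum_(d <- divisors n) moebius d * g (n %/ d)%N.
Proof.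
move=> gE n n0.
(* Both sums should range over the fixed list [divisors n], with the dependence on [e] moved into a
   filter, so that they can be exchanged. *)
have sumD (F : nat -> int) e : e \in divisors n ->
  \sum_(d <- divisors (n %/ e)) F d = \sum_(d <- divisors n | (d %| n %/ e)%N) F d.
  rewrite -dvdn_divisors // => en.
  have ne0 : (0 < n %/ e)%N by apply: divn_dvd_gt0.
  rewrite -[RHS]big_filter; apply/perm_big/uniq_perm.
  - exact: divisors_uniq.
  - by rewrite filter_uniq ?divisors_uniq.
  move=> d; rewrite mem_filter -!dvdn_divisors //.
  by apply/idP/andP => [dne|[]//]; split; rewrite // (dvdn_trans dne) ?dvdn_div.
have divC d e : d \in divisors n -> e \in divisors n ->
  (e %| n %/ d)%N = (d %| n %/ e)%N.
  rewrite -!dvdn_divisors // => dn en.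
  by rewrite !dvdn_divRL // mulnC.
symmetry; transitivity (\sum_(d <- divisors n)
    \sum_(e <- divisors n | (e %| n %/ d)%N) moebius d * f e).
  apply: eq_big_seq => d dn; rewrite -big_distrr /= -sumD // gE //.
  by move: dn; rewrite -dvdn_divisors //; apply: divn_dvd_gt0.
rewrite (exchange_big_dep xpredT) //=.
transitivity (\sum_(e <- divisors n) (e == n)%:R * f e).
  apply: eq_big_seq => e en; rewrite -big_distrl /=; congr (_ * _).
  rewrite big_seq_cond (eq_bigl (fun d => (d \in divisors n) && (d %| n %/ e)%N)); last first.
    by move=> d; have [dn|//] := boolP (d \in divisors n); rewrite /= divC.
  rewrite -big_seq_cond -sumD // sum_moebius.
    move: en; rewrite -dvdn_divisors // => en.
    by rewrite [(_ == 1%N)]eq_sym eqn_div ?(dvdn_gt0 n0 en) // mul1n.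
  by move: en; rewrite -dvdn_divisors //; apply: divn_dvd_gt0.
rewrite (bigD1_seq n) ?divisors_id ?divisors_uniq //= eqxx mul1r big1 ?addr0 //.
by move=> e /negPf ->; rewrite mul0r.
Qed.

End Moebius.

(** * The Euler operator q d/dq, logarithmic derivatives and q-adic limits *)

Section LogDerivative.
Local Open Scope ring_scope.
Variable K : fieldType.
Implicit Types f g h : fps K.

Definition fps_theta f : fps K := fps_X K * fps_deriv f.

Lemma fps_coef_theta f n : fps_theta f n = f n *+ n.
Proof.
rewrite fps_coefM; case: n => [|n]; first by rewrite big_ord1 mul0r mulr0n.
rewrite (bigD1 (inord 1)) //= inordK // mul1r subn1 big1 ?addr0 // => i.
by rewrite -val_eqE /= inordK // => /negPf ->; rewrite mul0r.
Qed.

Lemma fps_thetaM f g : fps_theta (f * g) = fps_theta f * g + f * fps_theta g.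
Proof.
apply: fpsP => n; rewrite fps_coef_theta fps_coefD !fps_coefM -sumrMnl -big_split.
apply: eq_bigr => i _; rewrite !fps_coef_theta mulrnAl mulrnAr /= -mulrnDr subnKC //.
by rewrite -ltnS.
Qed.

(** [H i] is the logarithmic derivative of [F i], written without division; logarithmic derivatives
    of a product add up. *)
Lemma fps_theta_prod (F H : nat -> fps K) (r : seq nat) (P : pred nat) :
    (forall i, P i -> fps_theta (F i) = H i * F i) ->
  fps_theta (\prod_(i <- r | P i) F i) =
    (\sum_(i <- r | P i) H i) * \prod_(i <- r | P i) F i.
Proof.
move=> FH; elim: r => [|i r IHr].
  rewrite !big_nil mul0r; apply: fpsP => n; rewrite fps_coef_theta fps_coef1.
  by case: n => // n; rewrite mul0rn.
rewrite !big_cons; case: ifP => // /FH Fi.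
by rewrite fps_thetaM IHr Fi mulrDl -mulrA [F i * (_ * _)]mulrCA.
Qed.

(** A single rank for all coefficients up to [k], as a Cauchy product involves them all. *)
Lemma fps_cvg_upto (u : nat -> fps K) f k : fps_cvg u f ->
  exists N, forall n i, (N <= n)%N -> (i <= k)%N -> u n i = f i.
Proof.
move=> uf; elim: k => [|k [N1 uN1]].
  by have [N uN] := uf 0%N; exists N => n i Nn; rewrite leqn0 => /eqP ->; apply: uN.
have [N2 uN2] := uf k.+1; exists (maxn N1 N2) => n i.
rewrite geq_max => /andP[N1n N2n]; rewrite leq_eqVlt => /predU1P[->|]; first exact: uN2.
by rewrite ltnS; apply: uN1.
Qed.

Lemma fps_cvgM (u v : nat -> fps K) f g :
  fps_cvg u f -> fps_cvg v g -> fps_cvg (fun n => u n * v n) (f * g).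
Proof.
move=> uf vg k; have [N1 uN] := fps_cvg_upto k uf; have [N2 vN] := fps_cvg_upto k vg.
exists (maxn N1 N2) => n; rewrite geq_max => /andP[N1n N2n]; rewrite !fps_coefM.
apply: eq_bigr => i _; rewrite uN ?vN ?leq_subr //; by rewrite -ltnS.
Qed.

Lemma fps_cvg_theta (u : nat -> fps K) f :
  fps_cvg u f -> fps_cvg (fun n => fps_theta (u n)) (fps_theta f).
Proof.
by move=> uf k; have [N uN] := uf k; exists N => n Nn; rewrite !fps_coef_theta uN.
Qed.

Lemma fps_cvg_unique (u v : nat -> fps K) f g :
  (forall n, u n = v n) -> fps_cvg u f -> fps_cvg v g -> f = g.
Proof.
move=> uv uf vg; apply: fpsP => k; have [N1 uN] := uf k; have [N2 vN] := vg k.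
by rewrite -(uN (maxn N1 N2)) ?leq_maxl // uv vN // leq_maxr.
Qed.

End LogDerivative.

(** * The logarithmic derivative of the infinite product *)

Section Psi.
Local Open Scope ring_scope.

Lemma gbinomS r k : gbinom r k.+1 *+ k.+1 = gbinom r k * (r - k%:R).
Proof.
rewrite /gbinom big_ord_recr /= factS natrM invfM -[LHS]mulr_natr -!mulrA.
by congr (_ * _); rewrite [_^-1 * k.+1%:R]mulrC mulKf ?pnatr_eq0 // mulrC.
Qed.

(** The coefficient of x^k in x d/dx (1-x)^r = -r x/(1-x) (1-x)^r. *)
Lemma gbinom_sum r k :
  gbinom r k * (-1) ^+ k *+ k = - r * \sum_(j < k) gbinom r j * (-1) ^+ j.
Proof.
elim: k => [|k IHk]; first by rewrite big_ord0 mulr0 mulr0n.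
rewrite big_ord_recr /= mulrDr -IHk exprS mulN1r -mulrnAl gbinomS.
by rewrite -[_ *+ k]mulr_natr; ring.
Qed.

(* q^n / (1 - q^n) *)
Definition geometric_Xn n : fps rat := Fps (fun i => ((0 < i) && (n %| i))%N%:R).

Lemma sum_dvdn (F : nat -> rat) n k : (0 < n)%N ->
  \sum_(0 <= i < n * k | (n %| i)%N) F (i %/ n)%N = \sum_(j < k) F j.
Proof.
move=> n0; elim: k => [|k IHk]; first by rewrite muln0 big_geq // big_ord0.
rewrite big_ord_recr /= -IHk mulnS [(n + _)%N]addnC (big_cat_nat (n := (n * k)%N)) ?leq_addr //=.
(* In the last block of [n] indices, only the first, [n * k], is a multiple of [n]. *)
congr (_ + _); rewrite big_ltn_cond; last by rewrite -{1}[(n * k)%N]addn0 ltn_add2l.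
rewrite dvdn_mulr // mulKn // big_nat_cond big1 ?addr0 // => i /andP[/andP[i1 i2]].
case/dvdnP => j iE; move: i1 i2.
by rewrite iE [(j * n)%N]mulnC -mulnSr !ltn_pmul2l // => kj; rewrite ltnS leqNgt kj.
Qed.

(** Both sides are supported on multiples of [n]; at [i = n * k] the identity is [gbinom_sum]. *)
Lemma theta_one_sub_Xn_pow n r : (0 < n)%N ->
  fps_theta (one_sub_Xn_pow n r) =
  fps_scale (- (r * n%:R)) (geometric_Xn n) * one_sub_Xn_pow n r.
Proof.
move=> n0; apply: fpsP => i; rewrite fps_coef_theta [fps_scale _ _ * _]mulrC fps_coefM.
(* The top term vanishes because [geometric_Xn] has no constant term, leaving a sum over [j < i]. *)
rewrite big_ord_recr /= subnn !mulr0 addr0.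
case: ifP => ni; last first.
  rewrite mul0rn big1 // => j _; case: ifP => nj; last by rewrite mul0r.
  by rewrite /= dvdn_subl ?(ltnW (ltn_ord j)) // ni andbF !mulr0.
have [k iE] := dvdnP ni.
transitivity (- (r * n%:R) *
    \sum_(0 <= j < n * k | (n %| j)%N) gbinom r (j %/ n) * (-1) ^+ (j %/ n)).
  rewrite (sum_dvdn (fun j => gbinom r j * (-1) ^+ j)) // iE mulnK // mulrnA gbinom_sum.
  by rewrite -[_ *+ n]mulr_natr -!mulNr mulrAC.
rewrite big_distrr big_mkcond /= mulnC -iE big_mkord; apply: eq_bigr => j _.
case: ifP => nj; last by rewrite mul0r.
by rewrite subn_gt0 ltn_ord dvdn_sub // mulr1 mulrC.
Qed.

Lemma cvg_sum_geometric_Xn (a : nat -> nat) :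
  fps_cvg
    (fun N => \sum_(1 <= n < N.+1) fps_scale (- (a n)%:R) (geometric_Xn n))
    (Fps (fun k => if k == 0%N then 0 else - (\sum_(d <- divisors k) a d)%:R)).
Proof.
(* Only divisors of [k] contribute to the coefficient of q^k, and for [k > 0] they are all at most
   [k]. *)
move=> k; exists k => N kN; rewrite fps_coef_sum /=.
have [->|k0] := posnP k; first by rewrite big1 // => n _; rewrite mulr0.
rewrite natr_sum -sumrN (eq_bigr (fun n => if (n %| k)%N then - (a n)%:R else 0)); last first.
  by move=> n _; case: ifP => _; rewrite ?mulr1 ?mulr0.
rewrite -big_mkcond -big_filter; apply/perm_big/uniq_perm.
- by rewrite filter_uniq ?iota_uniq.
- exact: divisors_uniq.
move=> d; rewrite mem_filter -dvdn_divisors // mem_index_iota ltnS.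
by apply: andb_idr => dk; rewrite (dvdn_gt0 k0 dk) (leq_trans _ kN) // dvdn_leq.
Qed.

(** The finite partial products satisfy the identity with finite sums; both sides then pass to the
    limit, which is unique. *)
Lemma theta_Psi (a : nat -> nat) :
  fps_theta (Psi a) =
    Fps (fun k => if k == 0%N then 0 else - (\sum_(d <- divisors k) a d)%:R) * Psi a.
Proof.
apply: fps_cvg_unique (fps_cvg_theta (Psi_cvg a))
  (fps_cvgM (cvg_sum_geometric_Xn a) (Psi_cvg a)) => N /=.
rewrite !big_nat; apply: fps_theta_prod => n /andP[n0 _].
(* The factor n brought down by differentiation cancels the denominator of the exponent
   [a n / n]. *)
by rewrite theta_one_sub_Xn_pow // divfK // pnatr_eq0 -lt0n.
Qed.

End Psi.

Theorem theorem1p1 :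
  (fps_X rat * fps_deriv (Psi Q) / Psi Q = - F_Qhat)%R /\
  (forall n : nat, (1 <= n)%N ->
     ((Q n)%:Z = \sum_(d <- divisors n) moebius d * (Qhat (n %/ d)%N)%:Z)%R).
Proof.
split.
  rewrite -[(fps_X rat * _)%R]/(fps_theta _) theta_Psi mulrK ?Psi_unit //.
  apply: fpsP => n; rewrite fps_coefN /=.
  by case: eqP => [_|/eqP n0]; rewrite ?oppr0 // Qhat_sum_Q // lt0n.
apply: (@moebius_inversion (fun n => (Q n)%:Z)%R (fun n => (Qhat n)%:Z)%R) => n n0.
by rewrite Qhat_sum_Q // (big_morph Posz PoszD (erefl _)).
Qed.
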